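(* Let $H$ be a colour Hopf algebra and let $A$ be a graded $H$-comodule colour algebra. Assume that there is a graded $H$-colinear map $\theta: H\to A$ such that $\theta(1_H)=1_A$. (1) Then every colour $(A,H)$-Hopf module is a gr-injective graded $H$-comodule. (2) If $A$ and $H$ are colour-commutative and the bicharacter is symmetric, then every colour $(A,H)$-Hopf module which is injective as a graded $A$-module is injective as a colour $(A,H)$-Hopf module.
   Context: $\Bbbk$ is a field and $G$ is a multiplicative abelian group with identity $e$ and a bicharacter $(\cdot/\cdot):G\times G\to\Bbbk^{\times}$, i.e. $(g/g'g'')=(g/g')(g/g'')$ and $(gg'/g'')=(g/g'')(g'/g'')$. The bicharacter is symmetric if $(g/g')(g'/g)=1$ for all $g,g'$. ''Graded'' means $G$-graded; $|m|$ is the degree of a homogeneous element $m$; formulas are written for homogeneous elements and extended linearly. A graded map $f:M\to N$ is a $\Bbbk$-linear map with $f(M_g)\subseteq N_g$ for all $g$. $\otimes=\otimes_{\Bbbk}$, graded by $(M\otimes N)_g=\bigoplus_{g'g''=g}M_{g'}\otimes N_{g''}$; $\Bbbk$ is in degree $e$. A colour algebra is a $G$-graded associative unital $\Bbbk$-algebra; it is colour-commutative if $ab=(|a|/|b|)ba$ for all homogeneous $a,b$. A colour Hopf algebra $H$ is a colour algebra which is also a (coassociative, counital) coalgebra with graded maps $\Delta_H$, $\varepsilon_H$ (write $\Delta_H(h)=h_1\otimes h_2$ with homogeneous components), such that $\varepsilon_H$ is a unital algebra map, $\Delta_H(1_H)=1_H\otimes 1_H$, $\Delta_H(hh')=(|h_2|/|h'_1|)\,h_1h'_1\otimes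 h_2h'_2$, and with a graded map $\mathcal S_H:H\to H$ (antipode) satisfying $h_1\mathcal S_H(h_2)=\varepsilon_H(h)1_H=\mathcal S_H(h_1)h_2$. A graded $H$-comodule is a graded vector space $M$ with a graded map $\chi_M:M\to H\otimes M$, $\chi_M(m)=m_{(-1)}\otimes m_{(0)}$, which is coassociative and counital (left comodule). $H$ is a graded $H$-comodule via $\Delta_H$. A graded $H$-colinear map is a graded map $f$ with $f(m)_{(-1)}\otimes f(m)_{(0)}=m_{(-1)}\otimes f(m_{(0)})$. A graded $H$-comodule is gr-injective if it is an injective object in the category of graded $H$-comodules and graded $H$-colinear maps, i.e. graded $H$-colinear maps into it extend along injective graded $H$-colinear maps. A graded $H$-comodule colour algebra is a colour algebra $A$ that is a graded $H$-comodule with $\chi_A(1_A)=1_H\otimes 1_A$ and $\chi_A(aa')=(|a_{(0)}|/|a'_{(-1)}|)\,a_{(-1)}a'_{(-1)}\otimes a_{(0)}a'_{(0)}$. A graded $A$-module is a graded vector space that is a left $A$-module with $A_gM_{g'}\subseteq M_{gg'}$; morphisms are graded $A$-linear maps. A colour $(A,H)$-Hopf module is a graded $A$-module and graded $H$-comodule $M$ (same grading) with $\chi_M(am)=(|a_{(0)}|/|m_{(-1)}|)\,a_{(-1)}m_{(-1)}\otimes a_{(0)}m_{(0)}$; morphisms are graded $A$-linear graded $H$-colinear maps; these form an abelian category. ''Injective as a graded $A$-module'' (resp. ''as a colour $(A,H)$-Hopf module'') means injective object in the corresponding category. *)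

(* Defs.v *)
From HB Require Import structures.
From mathcomp Require Import all_boot all_order all_algebra.
From mathcomp Require Import boolp.

Set Implicit Arguments.
Unset Strict Implicit.
Unset Printing Implicit Defensive.

Import GRing.Theory.

Local Open Scope ring_scope.
Local Open Scope quotient_scope.

(* [tensor U V] is the set of finite formal sums of pairs, two formal sums
   being identified when every bilinear map takes the same value on them.
   This is the congruence generated by the bilinearity relations, since the
   quotient map by that congruence is itself bilinear. *)

Section Tensor.
Variables (k : fieldType) (U V : lmodType k).

Definition tensor_rel (s t : seq (U * V)) : bool :=
  `[< forall (W : lmodType k) (B : {bilinear U -> V -> W}),
        \sum_(p <- s) B p.1 p.2 = \sum_(p <- t) B p.1 p.2 >].

Lemma tensor_rel_refl : reflexive tensor_rel.
Proof. by move=> s; apply/asboolP. Qed.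

Lemma tensor_rel_sym : symmetric tensor_rel.
Proof.
by move=> s t; apply/asboolP/asboolP => e W B; rewrite e.
Qed.

Lemma tensor_rel_trans : transitive tensor_rel.
Proof.
by move=> s t u /asboolP e1 /asboolP e2; apply/asboolP => W B; rewrite e1.
Qed.

Canonical tensor_equiv :=
  EquivRel tensor_rel tensor_rel_refl tensor_rel_sym tensor_rel_trans.

Definition tensor := {eq_quot tensor_equiv}.

HB.instance Definition _ := Choice.on tensor.
HB.instance Definition _ := EqQuotient.on tensor.

Definition tens (u : U) (v : V) : tensor := \pi_tensor [:: (u, v)].

(* Meaningful only when [B] is bilinear; see [tlift_tens] and
   [tlift_is_linear]. *)
Definition tlift (W : lmodType k) (B : U -> V -> W) (t : tensor) : W :=
  \sum_(p <- repr t) B p.1 p.2.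

Lemma tlift_pi (W : lmodType k) (B : {bilinear U -> V -> W}) s :
  tlift B (\pi_tensor s) = \sum_(p <- s) B p.1 p.2.
Proof.
rewrite /tlift; case: piP => s' /eqmodP /asboolP e.
by rewrite (e W B).
Qed.

Lemma tensor_eqP (s t : tensor) :
  (forall (W : lmodType k) (B : {bilinear U -> V -> W}),
     tlift B s = tlift B t) -> s = t.
Proof.
rewrite -[s]reprK -[t]reprK => e; apply/eqmodP/asboolP => W B.
by have := e W B; rewrite !tlift_pi.
Qed.

Definition tensor_zero : tensor := \pi_tensor [::].
Definition tensor_add (s t : tensor) : tensor :=
  \pi_tensor (repr s ++ repr t).
Definition tensor_scale (a : k) (t : tensor) : tensor :=
  \pi_tensor [seq (a *: p.1, p.2) | p <- repr t].
Definition tensor_opp (t : tensor) : tensor := tensor_scale (-1) t.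

Section Lift.
Variables (W : lmodType k) (B : {bilinear U -> V -> W}).

Lemma tlift0 : tlift B tensor_zero = 0.
Proof. by rewrite tlift_pi big_nil. Qed.

Lemma tliftD s t : tlift B (tensor_add s t) = tlift B s + tlift B t.
Proof. by rewrite tlift_pi big_cat. Qed.

Lemma tliftZ a t : tlift B (tensor_scale a t) = a *: tlift B t.
Proof.
rewrite tlift_pi big_map /tlift scaler_sumr; apply: eq_bigr => p _ /=.
exact: (linearZl_LR B).
Qed.

Lemma tliftN t : tlift B (tensor_opp t) = - tlift B t.
Proof. by rewrite tliftZ scaleN1r. Qed.

End Lift.

Let tliftE := (tlift0, tliftD, tliftZ, tliftN).

Lemma tensor_addA : associative tensor_add.
Proof. by move=> s t u; apply: tensor_eqP => W B; rewrite !tliftE addrA. Qed.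

Lemma tensor_addC : commutative tensor_add.
Proof. by move=> s t; apply: tensor_eqP => W B; rewrite !tliftE addrC. Qed.

Lemma tensor_add0 : left_id tensor_zero tensor_add.
Proof. by move=> s; apply: tensor_eqP => W B; rewrite !tliftE add0r. Qed.

Lemma tensor_addN : left_inverse tensor_zero tensor_opp tensor_add.
Proof. by move=> s; apply: tensor_eqP => W B; rewrite !tliftE addNr. Qed.

HB.instance Definition _ := GRing.isZmodule.Build tensor
  tensor_addA tensor_addC tensor_add0 tensor_addN.

Lemma tensor_scaleA a b t :
  tensor_scale a (tensor_scale b t) = tensor_scale (a * b) t.
Proof. by apply: tensor_eqP => W B; rewrite !tliftE scalerA. Qed.

Lemma tensor_scale1 : left_id 1 tensor_scale.
Proof. by move=> t; apply: tensor_eqP => W B; rewrite !tliftE scale1r. Qed.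

Lemma tensor_scaleDr : right_distributive tensor_scale +%R.
Proof.
by move=> a s t; apply: tensor_eqP => W B; rewrite !(tliftE, scalerDr).
Qed.

Lemma tensor_scaleDl t : {morph tensor_scale^~ t : a b / a + b}.
Proof.
by move=> a b; apply: tensor_eqP => W B; rewrite !(tliftE, scalerDl).
Qed.

HB.instance Definition _ := GRing.Zmodule_isLmodule.Build k tensor
  tensor_scaleA tensor_scale1 tensor_scaleDr tensor_scaleDl.

End Tensor.

Notation "u ⊗ v" := (tens u v) (at level 38, left associativity) : ring_scope.

Section TensorTheory.
Variables (k : fieldType) (U V : lmodType k).

Lemma tlift_is_linear (W : lmodType k) (B : {bilinear U -> V -> W}) :
  linear (tlift B : tensor U V -> W).
Proof. by move=> a s t; rewrite tliftD tliftZ. Qed.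

Lemma tlift_tens (W : lmodType k) (B : {bilinear U -> V -> W}) u v :
  tlift B (u ⊗ v) = B u v.
Proof. by rewrite tlift_pi big_seq1. Qed.

Lemma tens_is_bilinear :
  bilinear_for *:%R *:%R (@tens k U V : U -> V -> tensor U V).
Proof.
split=> [v a u u'|u a v v'] /=; apply: tensor_eqP => W B;
  by rewrite tlift_is_linear !tlift_tens ?linearPl ?linearPr.
Qed.

HB.instance Definition _ := bilinear_isBilinear.Build k U V (tensor U V)
  *:%R *:%R (@tens k U V) tens_is_bilinear.

Lemma tensor_span (t : tensor U V) : t = \sum_(p <- repr t) p.1 ⊗ p.2.
Proof.
apply: tensor_eqP => W B.
pose L := GRing.isLinear.Build k _ _ *:%R (tlift B) (tlift_is_linear B).
pose f : {linear tensor U V -> W} := HB.pack (tlift B) L.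
rewrite -[RHS]/(f _) linear_sum /=.
by apply: eq_bigr => p _; rewrite tlift_tens.
Qed.

End TensorTheory.

Definition tensor_map (k : fieldType) (U V U' V' : lmodType k)
    (f : U -> U') (g : V -> V') : tensor U V -> tensor U' V' :=
  tlift (fun u v => f u ⊗ g v).

Definition tensorA (k : fieldType) (U V W : lmodType k) :
    tensor (tensor U V) W -> tensor U (tensor V W) :=
  tlift (fun t w => tlift (fun u v => u ⊗ (v ⊗ w)) t).

Record bicharacter (k : fieldType) (G : groupType) := Bicharacter {
  bichar :> G -> G -> k;
  bichar_neq0 : forall g g', bichar g g' != 0;
  bicharMr : forall g g' g'',
    bichar g (g' * g'')%g = bichar g g' * bichar g g'';
  bicharMl : forall g g' g'',
    bichar (g * g')%g g'' = bichar g g'' * bichar g' g''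
}.

Definition symmetric_bichar (k : fieldType) (G : groupType)
    (chi : bicharacter k G) : Prop :=
  forall g g' : G, chi g g' * chi g' g = 1.

HB.mixin Record Lmodule_isGraded (k : fieldType) (G : groupType) V
    of GRing.Lmodule k V := {
  homog : G -> V -> Prop;
  homog0 : forall g, homog g 0;
  homogP : forall g (a : k) u v,
    homog g u -> homog g v -> homog g (a *: u + v);
  homog_decomp : forall v : V, exists (s : seq G) (f : G -> V),
    [/\ uniq s, forall g, homog g (f g) & v = \sum_(g <- s) f g];
  homog_indep : forall (s : seq G) (f : G -> V),
    uniq s -> (forall g, homog g (f g)) -> \sum_(g <- s) f g = 0 ->
    forall g, g \in s -> f g = 0
}.

#[short(type="gradedSpaceType")]
HB.structure Definition GradedSpace (k : fieldType) (G : groupType) :=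
  {V of Lmodule_isGraded k G V & GRing.Lmodule k V}.

Arguments homog {k G s} g v.

Definition graded_map (k : fieldType) (G : groupType)
    (M N : gradedSpaceType k G) (f : M -> N) : Prop :=
  forall (g : G) (m : M), homog g m -> homog g (f m).

Section Components.
Variables (k : fieldType) (G : groupType) (V : gradedSpaceType k G).
Implicit Types (u v : V) (g : G) (s : seq G) (c : G -> V).

Lemma homogD g u v : homog g u -> homog g v -> homog g (u + v).
Proof. by move=> hu hv; rewrite -[u]scale1r; apply: homogP. Qed.

Lemma homogZ g a v : homog g v -> homog g (a *: v).
Proof. by move=> hv; rewrite -[_ *: _]addr0; apply: homogP => //; apply: homog0. Qed.

Definition components v c s : Prop :=
  [/\ uniq s, forall g, homog g (c g), forall g, g \notin s -> c g = 0
    & v = \sum_(g <- s) c g].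

Lemma components_ex v : exists c s, components v c s.
Proof.
have [s [f [us hf ->]]] := homog_decomp (G := G) v.
exists (fun g => if g \in s then f g else 0), s; split=> //.
- by move=> g; case: ifP => // _; apply: homog0.
- by move=> g /negbTE ->.
- by rewrite [LHS]big_seq [RHS]big_seq; apply: eq_bigr => g ->.
Qed.

Lemma components_widen v c s s' :
  uniq s' -> {subset s <= s'} -> components v c s -> components v c s'.
Proof.
move=> us' ss' [us hc c0 ->]; split=> //.
  by move=> g gs'; apply: c0; apply: contra gs'; apply: ss'.
rewrite [RHS](bigID (mem s)) /= [X in _ + X]big1 ?addr0; last first.
  by move=> g /c0.
rewrite -[RHS]big_filter; apply: perm_big; apply: uniq_perm => //.
  exact: filter_uniq.
move=> g; rewrite mem_filter /=; case: (boolP (g \in s)) => //= /ss' -> //.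
Qed.

Lemma components_inj v c c' s s' :
  components v c s -> components v c' s' -> c =1 c'.
Proof.
move=> h h' g; pose s2 := undup (g :: s ++ s').
have us2 : uniq s2 by apply: undup_uniq.
have {h} [|_ hc _ vE] := components_widen us2 _ h.
  by move=> x xs; rewrite mem_undup inE mem_cat xs orbT.
have {h'} [|_ hc' _ vE'] := components_widen us2 _ h'.
  by move=> x xs; rewrite mem_undup inE mem_cat xs !orbT.
apply/eqP; rewrite -subr_eq0; apply/eqP.
apply: (homog_indep s2 (fun g => c g - c' g)) => //.
- by move=> x; rewrite addrC -scaleN1r; apply: homogP.
- by rewrite sumrB -vE -vE' subrr.
- by rewrite mem_undup inE eqxx.
Qed.

Definition gcomp g v : V := projT1 (cid (components_ex v)) g.

Lemma gcomp_components v : exists s, components v (gcomp^~ v) s.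
Proof. by rewrite /gcomp; case: cid => c [s h] /=; exists s. Qed.

Lemma gcompE v c s g : components v c s -> gcomp g v = c g.
Proof.
by move=> h; have [s' h'] := gcomp_components v; apply: components_inj h' h g.
Qed.

Lemma gcomp_homog g v : homog g (gcomp g v).
Proof. by have [s []] := gcomp_components v. Qed.

Lemma gcomp_id g v : homog g v -> gcomp g v = v.
Proof.
move=> hv; rewrite (@gcompE v (fun g' => if g' == g then v else 0) [:: g]).
  by rewrite eqxx.
split=> //; last by rewrite big_seq1 eqxx.
  by move=> g'; case: eqP => [->//|_]; apply: homog0.
by move=> g'; rewrite inE => /negbTE ->.
Qed.

Lemma gcomp_neq g g' v : homog g v -> g' != g -> gcomp g' v = 0.
Proof.
move=> hv ng; rewrite (@gcompE v (fun g' => if g' == g then v else 0) [:: g]).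
  by rewrite (negbTE ng).
split=> //; last by rewrite big_seq1 eqxx.
  by move=> h; case: eqP => [->//|_]; apply: homog0.
by move=> h; rewrite inE => /negbTE ->.
Qed.

Lemma gcomp_is_linear g : linear (gcomp g).
Proof.
move=> a u v; have [s hu] := gcomp_components u.
have [s' hv] := gcomp_components v.
pose s2 := undup (s ++ s').
have us2 : uniq s2 by apply: undup_uniq.
have {hu} [|_ hcu u0 uE] := components_widen us2 _ hu.
  by move=> x xs; rewrite mem_undup mem_cat xs.
have {hv} [|_ hcv v0 vE] := components_widen us2 _ hv.
  by move=> x xs; rewrite mem_undup mem_cat xs orbT.
apply: (@gcompE _ (fun g => a *: gcomp g u + gcomp g v) s2); split=> //.
- by move=> h; apply: homogP.
- by move=> h hs; rewrite u0 ?v0 // scaler0 addr0.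
- by rewrite big_split /= -scaler_sumr -uE -vE.
Qed.

HB.instance Definition _ g :=
  GRing.isLinear.Build k V V *:%R (gcomp g) (gcomp_is_linear g).

Lemma homog_ind (P : V -> Prop) :
  (forall u v, P u -> P v -> P (u + v)) -> P 0 ->
  (forall g v, homog g v -> P v) -> forall v, P v.
Proof.
move=> PD P0 Ph v; have [s [_ h _ ->]] := gcomp_components v.
by apply: big_ind => // g _; apply: Ph (h g).
Qed.

End Components.

Section TensorGraded.
Variables (k : fieldType) (G : groupType) (U V : gradedSpaceType k G).
Implicit Types (s t : tensor U V).

(* [t] is the sum of the elementary tensors [u i ⊗ v i], in which [u i] and
   [v i] are homogeneous of degrees [du i] and [dv i]. *)
Definition homog_sum n (u : 'I_n -> U) (v : 'I_n -> V) (du dv : 'I_n -> G)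
    (t : tensor U V) : Prop :=
  [/\ forall i, homog (du i) (u i), forall i, homog (dv i) (v i)
    & t = \sum_i u i ⊗ v i].

Definition tensor_homog (g : G) (t : tensor U V) : Prop :=
  exists n (u : 'I_n -> U) (v : 'I_n -> V) (du dv : 'I_n -> G),
    homog_sum u v du dv t /\ forall i, (du i * dv i)%g = g.

Lemma tensor_homog0 g : tensor_homog g 0.
Proof.
exists 0%N, (fun _ => 0), (fun _ => 0), (fun _ => 1%g), (fun _ => 1%g).
by split; [split; [case | case | rewrite big_ord0] | case].
Qed.

Lemma tensor_homogP g (a : k) s t :
  tensor_homog g s -> tensor_homog g t -> tensor_homog g (a *: s + t).
Proof.
move=> [n [u [v [du [dv [[hu hv ->] e]]]]]].
move=> [n' [u' [v' [du' [dv' [[hu' hv' ->] e']]]]]].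
pose cs T (x : 'I_n -> T) (x' : 'I_n' -> T) (i : 'I_(n + n')) :=
  match split i with inl j => x j | inr j => x' j end.
exists (n + n')%N, (cs _ (fun i => a *: u i) u'), (cs _ v v'),
  (cs _ du du'), (cs _ dv dv').
have csl T x x' i : @cs T x x' (lshift n' i) = x i.
  by rewrite /cs (unsplitK (inl i)).
have csr T x x' i : @cs T x x' (rshift n i) = x' i.
  by rewrite /cs (unsplitK (inr i)).
split; first split.
- by move=> i; rewrite /cs; case: split => j //; apply: homogZ.
- by move=> i; rewrite /cs; case: split.
- rewrite big_split_ord /= scaler_sumr; congr (_ + _); apply: eq_bigr => i _.
    by rewrite !csl (linearZl_LR (@tens k U V)).
  by rewrite !csr.
- by move=> i; rewrite /cs; case: split.
Qed.

Lemma tensor_homog_tens g g' u v :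
  homog g u -> homog g' v -> tensor_homog (g * g')%g (u ⊗ v).
Proof.
move=> hu hv; exists 1%N, (fun _ => u), (fun _ => v), (fun _ => g), (fun _ => g').
by split=> //; split=> //; rewrite big_ord1.
Qed.

Lemma tensor_homog_decomp t : exists (s : seq G) (f : G -> tensor U V),
  [/\ uniq s, forall g, tensor_homog g (f g) & t = \sum_(g <- s) f g].
Proof.
pose P t := exists (s : seq G) (f : G -> tensor U V),
  [/\ uniq s, forall g, tensor_homog g (f g) & t = \sum_(g <- s) f g].
have P0 : P 0.
  exists [::], (fun _ => 0); split=> //; last by rewrite big_nil.
  by move=> g; apply: tensor_homog0.
have PD t1 t2 : P t1 -> P t2 -> P (t1 + t2).
  move=> [s1 [f1 [u1 h1 ->]]] [s2 [f2 [u2 h2 ->]]].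
  have widen (s : seq G) (f : G -> tensor U V) : uniq s ->
      {subset s <= undup (s1 ++ s2)} ->
      \sum_(g <- s) f g =
      \sum_(g <- undup (s1 ++ s2)) (if g \in s then f g else 0).
    move=> us ss; rewrite -big_mkcond /= -[RHS]big_filter.
    apply: perm_big; apply: uniq_perm => //.
      by apply: filter_uniq; apply: undup_uniq.
    move=> g; rewrite mem_filter.
    by case: (boolP (g \in s)) => //= /ss ->.
  exists (undup (s1 ++ s2)), (fun g =>
    (if g \in s1 then f1 g else 0) + (if g \in s2 then f2 g else 0)).
  split; first exact: undup_uniq.
    move=> g; rewrite -[X in X + _]scale1r; apply: tensor_homogP.
      by case: ifP => // _; apply: tensor_homog0.
    by case: ifP => // _; apply: tensor_homog0.
  rewrite big_split /= -!widen // => g gs; rewrite mem_undup mem_cat gs //.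
  by rewrite orbT.
have Ph g t1 : tensor_homog g t1 -> P t1.
  move=> h; exists [:: g], (fun g' => if g' == g then t1 else 0).
  split=> //; last by rewrite big_seq1 eqxx.
  by move=> g'; case: eqP => [->//|_]; apply: tensor_homog0.
rewrite (tensor_span t); apply: (big_ind P) => // -[u v] _ /=.
elim/(@homog_ind k G U): u.
- by move=> u u' Pu Pu'; rewrite (linearDl (@tens k U V)); apply: PD.
- by rewrite (linear0l (@tens k U V)).
move=> g u hu; elim/(@homog_ind k G V): v.
- by move=> v v' Pv Pv'; rewrite linearDr; apply: PD.
- by rewrite linear0r.
by move=> g' v hv; apply: (Ph _ _ (tensor_homog_tens hu hv)).
Qed.

Definition tens_comp (g g' : G) (u : U) (v : V) : tensor U V :=
  gcomp g u ⊗ gcomp g' v.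

Lemma tens_comp_bilinear g g' : bilinear_for *:%R *:%R (tens_comp g g').
Proof.
by split=> [v a u u'|u a v v'] /=; rewrite /tens_comp linearP ?linearPl ?linearPr.
Qed.

HB.instance Definition _ g g' := bilinear_isBilinear.Build k U V (tensor U V)
  *:%R *:%R (tens_comp g g') (tens_comp_bilinear g g').

Definition tcomp (g g' : G) : tensor U V -> tensor U V :=
  tlift (tens_comp g g').

HB.instance Definition _ g g' := GRing.isLinear.Build k _ _ *:%R (tcomp g g')
  (tlift_is_linear (tens_comp g g')).

Lemma tcomp_tens a b g g' u v : homog g u -> homog g' v ->
  tcomp a b (u ⊗ v) = if (a, b) == (g, g') then u ⊗ v else 0.
Proof.
move=> hu hv; rewrite /tcomp tlift_tens /= /tens_comp xpair_eqE.
have [->|na] := eqVneq a g; last first.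
  by rewrite (gcomp_neq hu na) (linear0l (@tens k U V)).
have [->|nb] := eqVneq b g'; last by rewrite (gcomp_neq hv nb) linear0r.
by rewrite !gcomp_id.
Qed.

Lemma tcomp_homog a b g t : tensor_homog g t -> (a * b)%g != g ->
  tcomp a b t = 0.
Proof.
move=> [n [u [v [du [dv [[hu hv ->] e]]]]]] ne.
rewrite linear_sum big1 //= => i _; rewrite (tcomp_tens _ _ (hu i) (hv i)).
case: eqP => // -[ea eb]; move: ne; by rewrite ea eb e eqxx.
Qed.

Lemma tcomp_inj g t : tensor_homog g t -> (forall a b, tcomp a b t = 0) -> t = 0.
Proof.
move=> [n [u [v [du [dv [[hu hv tE] e]]]]]] t0.
pose S := undup [seq (du i, dv i) | i : 'I_n].
have <- : \sum_(p <- S) tcomp p.1 p.2 t = 0 by apply: big1 => p _; apply: t0.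
transitivity (\sum_(p <- S) \sum_i tcomp p.1 p.2 (u i ⊗ v i)); last first.
  by apply: eq_bigr => p _; rewrite tE linear_sum.
rewrite exchange_big tE; apply: eq_bigr => i _ /=.
rewrite (bigD1_seq (du i, dv i)) ?undup_uniq //=; last first.
  by rewrite mem_undup; apply: map_f; rewrite mem_enum.
rewrite (tcomp_tens _ _ (hu i) (hv i)) eqxx big1 ?addr0 // => -[a b] /= ne.
by rewrite (tcomp_tens _ _ (hu i) (hv i)) (negbTE ne).
Qed.

Lemma tensor_homog_indep (s : seq G) (f : G -> tensor U V) :
  uniq s -> (forall g, tensor_homog g (f g)) -> \sum_(g <- s) f g = 0 ->
  forall g, g \in s -> f g = 0.
Proof.
move=> us hf f0 g gs; apply: (tcomp_inj (hf g)) => a b.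
have [abg|ab] := eqVneq (a * b)%g g; last exact: tcomp_homog (hf g) ab.
have := congr1 (tcomp a b) f0; rewrite linear0 linear_sum.
rewrite (bigD1_seq g) //= big1 ?addr0 // => h hg.
by apply: tcomp_homog (hf h) _; rewrite abg eq_sym.
Qed.

HB.instance Definition _ := Lmodule_isGraded.Build k G (tensor U V)
  tensor_homog0 tensor_homogP tensor_homog_decomp tensor_homog_indep.

End TensorGraded.

(* The product twisted by the bicharacter,
     (u ⊗ v)(u' ⊗ v') = (|v|/|u'|) uu' ⊗ vv'   for homogeneous v and u',
   induced by two products [mU] and [mV]; [twisted_prod chi mU mV s t r] says
   that [r] is the product of [s] and [t], computed from any expressions of
   [s] and [t] as sums of homogeneous elementary tensors. *)
Definition twisted_prod (k : fieldType) (G : groupType) (chi : bicharacter k G)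
    (U V U' V' U'' V'' : gradedSpaceType k G)
    (mU : U -> U' -> U'') (mV : V -> V' -> V'')
    (s : tensor U V) (t : tensor U' V') (r : tensor U'' V'') : Prop :=
  forall n (u : 'I_n -> U) (v : 'I_n -> V) (du dv : 'I_n -> G)
         n' (u' : 'I_n' -> U') (v' : 'I_n' -> V') (du' dv' : 'I_n' -> G),
    homog_sum u v du dv s -> homog_sum u' v' du' dv' t ->
    r = \sum_i \sum_j
          chi (dv i) (du' j) *: (mU (u i) (u' j) ⊗ mV (v i) (v' j)).

(* The product is bundled as a bilinear map instead of using [algType], in
   which [1 != 0], so that the zero algebra is not excluded. *)
HB.mixin Record isColourAlgebra (k : fieldType) (G : groupType) A
    of GradedSpace k G A := {
  cmul : {bilinear A -> A -> A};
  cone : A;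
  cmulA : forall a b c : A, cmul a (cmul b c) = cmul (cmul a b) c;
  cmul1r : forall a : A, cmul cone a = a;
  cmulr1 : forall a : A, cmul a cone = a;
  cone_homog : homog (1%g : G) cone;
  cmul_homog : forall (g g' : G) (a b : A),
    homog g a -> homog g' b -> homog (g * g')%g (cmul a b)
}.

#[short(type="colourAlgType")]
HB.structure Definition ColourAlgebra (k : fieldType) (G : groupType) :=
  {A of isColourAlgebra k G A & GradedSpace k G A}.

Notation "a ∙ b" := (cmul a b) (at level 40, left associativity) : ring_scope.

Definition colour_commutative (k : fieldType) (G : groupType)
    (chi : bicharacter k G) (A : colourAlgType k G) : Prop :=
  forall (g g' : G) (a b : A), homog g a -> homog g' b ->
    a ∙ b = chi g g' *: (b ∙ a).

HB.mixin Record isColourHopfAlgebra (k : fieldType) (G : groupType)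
    (chi : bicharacter k G) H of ColourAlgebra k G H := {
  comul : {linear H -> tensor H H};
  counit : {linear H -> k^o};
  antipode : {linear H -> H};
  comul_graded : graded_map comul;
  (* [k] is concentrated in degree [1] *)
  counit_graded : forall (g : G) (h : H),
    homog g h -> g != 1%g -> counit h = 0;
  antipode_graded : graded_map antipode;
  comulA : forall h : H,
    tensorA (tensor_map comul id (comul h)) = tensor_map id comul (comul h);
  counitl : forall h : H,
    tlift (fun h1 h2 : H => counit h1 *: h2) (comul h) = h;
  counitr : forall h : H,
    tlift (fun h1 h2 : H => counit h2 *: h1) (comul h) = h;
  counit1 : counit (cone : H) = 1;
  counitM : forall h h' : H, counit (h ∙ h') = counit h * counit h';
  comul1 : comul cone = (cone : H) ⊗ (cone : H);
  comulM : forall h h' : H,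
    twisted_prod chi cmul cmul (comul h) (comul h') (comul (h ∙ h'));
  antipoder : forall h : H,
    tlift (fun h1 h2 : H => h1 ∙ antipode h2) (comul h) = counit h *: (cone : H);
  antipodel : forall h : H,
    tlift (fun h1 h2 : H => antipode h1 ∙ h2) (comul h) = counit h *: (cone : H)
}.

#[short(type="colourHopfType")]
HB.structure Definition ColourHopfAlgebra (k : fieldType) (G : groupType)
    (chi : bicharacter k G) :=
  {H of isColourHopfAlgebra k G chi H & ColourAlgebra k G H}.

HB.mixin Record isGradedComodule (k : fieldType) (G : groupType)
    (chi : bicharacter k G) (H : colourHopfType chi) M
    of GradedSpace k G M := {
  coact : {linear M -> tensor H M};
  coact_graded : graded_map coact;
  coactA : forall m : M,
    tensorA (tensor_map comul id (coact m)) = tensor_map id coact (coact m);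
  coact_counit : forall m : M,
    tlift (fun (h : H) (m0 : M) => counit h *: m0) (coact m) = m
}.

#[short(type="gradedComodType")]
HB.structure Definition GradedComodule (k : fieldType) (G : groupType)
    (chi : bicharacter k G) (H : colourHopfType chi) :=
  {M of isGradedComodule k G chi H M & GradedSpace k G M}.

#[non_forgetful_inheritance]
HB.instance Definition _ (k : fieldType) (G : groupType)
    (chi : bicharacter k G) (H : colourHopfType chi) :=
  isGradedComodule.Build k G chi H H comul_graded comulA counitl.

Arguments GradedComodule.axioms_ : clear implicits.

Definition colinear (k : fieldType) (G : groupType) (chi : bicharacter k G)
    (H : colourHopfType chi) (M N : gradedComodType H)
    (f : {linear M -> N}) : Prop :=
  graded_map f /\ forall m : M, coact (f m) = tensor_map id f (coact m).

Definition gr_injective_comod (k : fieldType) (G : groupType)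
    (chi : bicharacter k G) (H : colourHopfType chi)
    (M : gradedComodType H) : Prop :=
  forall (N N' : gradedComodType H) (i : {linear N -> N'})
         (f : {linear N -> M}),
    colinear i -> injective i -> colinear f ->
    exists f' : {linear N' -> M}, colinear f' /\ forall n, f' (i n) = f n.

HB.mixin Record isGradedModule (k : fieldType) (G : groupType)
    (A : colourAlgType k G) M of GradedSpace k G M := {
  gact : {bilinear A -> M -> M};
  gactA : forall (a b : A) (m : M), gact (a ∙ b) m = gact a (gact b m);
  gact1 : forall m : M, gact cone m = m;
  gact_homog : forall (g g' : G) (a : A) (m : M),
    homog g a -> homog g' m -> homog (g * g')%g (gact a m)
}.

#[short(type="gradedModType")]
HB.structure Definition GradedModule (k : fieldType) (G : groupType)
    (A : colourAlgType k G) :=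
  {M of isGradedModule k G A M & GradedSpace k G M}.

Arguments GradedModule.axioms_ : clear implicits.

Definition graded_linear (k : fieldType) (G : groupType)
    (A : colourAlgType k G) (M N : gradedModType A)
    (f : {linear M -> N}) : Prop :=
  graded_map f /\ forall (a : A) (m : M), f (gact a m) = gact a (f m).

Definition injective_gradedMod (k : fieldType) (G : groupType)
    (A : colourAlgType k G) (M : gradedModType A) : Prop :=
  forall (N N' : gradedModType A) (i : {linear N -> N'})
         (f : {linear N -> M}),
    graded_linear i -> injective i -> graded_linear f ->
    exists f' : {linear N' -> M}, graded_linear f' /\ forall n, f' (i n) = f n.

HB.mixin Record isComoduleColourAlgebra (k : fieldType) (G : groupType)
    (chi : bicharacter k G) (H : colourHopfType chi) A
    of ColourAlgebra k G A & GradedComodule k G chi H A := {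
  coact1 : coact (cone : A) = (cone : H) ⊗ (cone : A);
  coactM : forall a a' : A,
    twisted_prod chi (@cmul k G H) (@cmul k G A)
      (coact a) (coact a') (coact (a ∙ a'))
}.

#[short(type="comodColourAlgType")]
HB.structure Definition ComoduleColourAlgebra (k : fieldType) (G : groupType)
    (chi : bicharacter k G) (H : colourHopfType chi) :=
  {A of isComoduleColourAlgebra k G chi H A & ColourAlgebra k G A
      & GradedComodule k G chi H A}.

HB.mixin Record isColourHopfModule (k : fieldType) (G : groupType)
    (chi : bicharacter k G) (H : colourHopfType chi)
    (A : comodColourAlgType H) M
    of GradedModule k G A M & GradedComodule k G chi H M := {
  coact_gact : forall (a : A) (m : M),
    twisted_prod chi (@cmul k G H) (gact : A -> M -> M)
      (coact a) (coact m) (coact (gact a m))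
}.

#[short(type="colourHopfModType")]
HB.structure Definition ColourHopfModule (k : fieldType) (G : groupType)
    (chi : bicharacter k G) (H : colourHopfType chi)
    (A : comodColourAlgType H) :=
  {M of isColourHopfModule k G chi H A M & GradedModule k G A M
      & GradedComodule k G chi H M}.

Definition hopf_linear (k : fieldType) (G : groupType) (chi : bicharacter k G)
    (H : colourHopfType chi) (A : comodColourAlgType H)
    (M N : colourHopfModType A) (f : {linear M -> N}) : Prop :=
  graded_linear f /\ colinear f.

Definition injective_colourHopfMod (k : fieldType) (G : groupType)
    (chi : bicharacter k G) (H : colourHopfType chi)
    (A : comodColourAlgType H) (M : colourHopfModType A) : Prop :=
  forall (N N' : colourHopfModType A) (i : {linear N -> N'})
         (f : {linear N -> M}),
    hopf_linear i -> injective i -> hopf_linear f ->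
    exists f' : {linear N' -> M}, hopf_linear f' /\ forall n, f' (i n) = f n.

(* Main.v *)
(* For a colour Hopf module M, the map Psi : h ⊗ m |-> h m_(-1) ⊗ m_(0) of
   H ⊗ M is bijective, with inverse Phi : h ⊗ m |-> h S(m_(-1)) ⊗ m_(0).  Put
   lambda (h ⊗ m) = theta (h S(m_(-1))) m_(0), so that lambda (Psi (h ⊗ m)) is
   theta (h) m and lambda is a retraction of the coaction of M.  It suffices to
   check identities about lambda on elements Psi (h ⊗ m), which avoids computing
   the coproduct of an antipode: in this way lambda is colinear from H ⊗ M with
   the coaction of H to M and, when A and H are colour-commutative, A-linear for
   the diagonal action on H ⊗ M.
     Hence every graded linear map g : N -> M from a graded comodule yields a
   colinear map n |-> lambda (n_(-1) ⊗ g n_(0)), which is A-linear if g is, and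
   which extends any colinear f that g extends.  Such a g exists over the field
   by choosing a complement and truncating degree by degree, and in the second
   part by injectivity of M as a graded module. *)
Require Import Defs.
From HB Require Import structures.
From mathcomp Require Import all_boot all_order all_algebra.
From mathcomp Require Import boolp classical_sets.

Set Implicit Arguments.
Unset Strict Implicit.
Unset Printing Implicit Defensive.

Import GRing.Theory.

Local Open Scope ring_scope.

(** * Linear retractions over a field, by Zorn's lemma *)

Section LinearRetraction.
Variables (k : fieldType) (U V : lmodType k) (i : {linear U -> V}).

(* The empty set has this property, as the empty chain in Zorn's lemma requires. *)
Definition meets_trivially (W : set V) : Prop :=
  (forall a u v, W u -> W v -> W (a *: u + v)) /\
  (forall x, W (i x) -> i x = 0).

Lemma maximal_meets_trivially :
  exists W, meets_trivially W /\
    forall B, (W `<` B)%classic -> ~ meets_trivially B.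
Proof.
apply: Zorn_bigcup => F sF totF; split=> [a u v [X FX Xu] [Y FY Yv]|x [X FX]].
  have [XY|YX] := totF X Y FX FY.
    by exists Y => //; apply: (sF Y FY).1 => //; apply: XY.
  by exists X => //; apply: (sF X FX).1 => //; apply: YX.
exact: (sF X FX).2.
Qed.

(** A maximal [W] works: if [v] were outside [W] plus the image of [i], the span of [W] and [v]
    would be strictly larger and still meet that image trivially. *)
Lemma complement_ex : exists W : V -> Prop,
  [/\ forall a u v, W u -> W v -> W (a *: u + v),
      forall x, W (i x) -> i x = 0
    & forall v, exists x, W (v - i x)].
Proof.
have [W [[WP Wi] Wmax]] := maximal_meets_trivially.
(* Otherwise adjoining 0 to [W] would contradict maximality. *)
have W0 : W 0.
  apply: contrapT => W0; apply: (Wmax [set v | W v \/ v = 0]%classic).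
    by split=> [v|/(_ 0)]; [left | move/(_ (or_intror erefl))].
  split=> [a u v [Wu|->] [Wv|->]|x [/Wi//|//]].
  - by left; apply: WP.
  (* As 0 is not yet known to lie in [W], [a *: u] is obtained as [(a - 1) *: u + u]. *)
  - by left; rewrite addr0 -[u]scale1r scalerA mulr1 -[a](subrK 1) scalerDl;
      apply: WP => //; rewrite scale1r.
  - by left; rewrite scaler0 add0r.
  - by right; rewrite scaler0 addr0.
exists W; split=> // v; apply: contrapT => nv.
pose B : set V := [set x | exists c w, W w /\ x = c *: v + w]%classic.
have WZ a u : W u -> W (a *: u) by move=> Wu; rewrite -[_ *: _]addr0; apply: WP.
apply: (Wmax B).
  split=> [w Ww|/(_ v) BW]; first by exists 0, w; rewrite scale0r add0r.
  apply: nv; exists 0; rewrite linear0 subr0; apply: BW.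
  by exists 1, 0; rewrite scale1r addr0.
split=> [a _ _ [c [w [Ww ->]]] [c' [w' [Ww' ->]]]|x [c [w [Ww ix]]]].
  exists (a * c + c'), (a *: w + w'); split; first exact: WP.
  by rewrite scalerDl scalerDr scalerA addrACA.
(* If [c] is nonzero, [v] differs from [i (c^-1 *: x)] by a multiple of [w], contrary to the choice
   of [v]. *)
have [c0|c_neq0] := eqVneq c 0.
  by apply: Wi; rewrite ix c0 scale0r add0r.
case: nv; exists (c^-1 *: x); rewrite linearZ ix /= scalerDr scalerA mulVf //.
by rewrite scale1r opprD addrA subrr sub0r -scaleN1r; apply/WZ/WZ.
Qed.

(** The retraction projects along the complement [W]: [p v] is the only [x] with [v - i x] in [W],
    and uniqueness yields both linearity and [p (i x) = x]. *)
Lemma linear_retraction : injective i -> exists p : {linear V -> U}, cancel i p.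
Proof.
move=> inj_i; have [W [WP Wi Wex]] := complement_ex.
pose p v := projT1 (cid (Wex v)).
have pP v : W (v - i (p v)) by rewrite /p; case: cid.
have Wuniq v x y : W (v - i x) -> W (v - i y) -> x = y.
  move=> Wx Wy; apply/eqP; rewrite -subr_eq0; apply/eqP/inj_i; rewrite linear0.
  apply: Wi; have := WP (-1) _ _ Wx Wy.
  by rewrite scaleN1r opprB linearB addrA subrK.
have p_lin : linear p.
  move=> a u v; apply: (Wuniq (a *: u + v)) => //.
  by rewrite linearP opprD addrACA -scalerBr; apply: WP.
pose P := GRing.isLinear.Build k V U *:%R p p_lin.
exists (HB.pack_for {linear V -> U} p P) => x /=.
by apply: (Wuniq (i x)) => //; rewrite subrr -[0](subrr (i 0)) linear0;
  have := WP (-1) _ _ (pP 0) (pP 0); rewrite scaleN1r addNr subrr.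
Qed.

End LinearRetraction.

(** * Linear maps assembled degree by degree, and graded extensions *)

Section GradedSums.
Variables (k : fieldType) (G : groupType) (V : gradedSpaceType k G).
Variables (W : lmodType k) (phi : G -> {linear V -> W}).

Definition degreewise (v : V) : W :=
  \sum_(g <- projT1 (cid (gcomp_components v))) phi g (gcomp g v).

(** The value does not depend on the chosen support: two supports are compared inside their union,
    where the extra components vanish. *)
Lemma degreewiseE v s : components v (fun g => gcomp g v) s ->
  degreewise v = \sum_(g <- s) phi g (gcomp g v).
Proof.
rewrite /degreewise; case: cid => s' /= hs' hs.
have widen r r' : uniq r' -> {subset r <= r'} ->
      components v (fun g => gcomp g v) r ->
    \sum_(g <- r) phi g (gcomp g v) = \sum_(g <- r') phi g (gcomp g v).
  move=> ur' rr' [ur _ v0 _]; rewrite [RHS](bigID (mem r)) /=.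
  rewrite [X in _ + X]big1 => [|g /v0 ->]; last by rewrite linear0.
  rewrite addr0 -[RHS]big_filter; apply: perm_big; apply: uniq_perm => //.
    exact: filter_uniq.
  by move=> g; rewrite mem_filter; case: (boolP (g \in r)) => //= /rr' ->.
rewrite (widen s' (undup (s' ++ s))) ?(widen s (undup (s' ++ s))) //;
  by [exact: undup_uniq | move=> g gs; rewrite mem_undup mem_cat gs ?orbT].
Qed.

Lemma degreewise_linear : linear degreewise.
Proof.
move=> a u v; have [s hu] := gcomp_components u.
have [s' hv] := gcomp_components v.
pose r := undup (s ++ s'); have ur : uniq r by apply: undup_uniq.
have {}hu : components u (fun g => gcomp g u) r.
  by apply: components_widen hu => // x xs; rewrite mem_undup mem_cat xs.
have {}hv : components v (fun g => gcomp g v) r.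
  by apply: components_widen hv => // x xs; rewrite mem_undup mem_cat xs orbT.
rewrite (degreewiseE hu) (degreewiseE hv) (@degreewiseE _ r).
  by rewrite scaler_sumr -big_split; apply: eq_bigr => g _; rewrite !linearP.
have [[_ hcu u0 uE] [_ hcv v0 vE]] := (hu, hv); split=> // [g|g gr|].
- exact: gcomp_homog.
- by rewrite linearP /= u0 ?v0 // scaler0 addr0.
- rewrite {1}uE {1}vE scaler_sumr -big_split; apply: eq_bigr => g _ /=.
  by rewrite linearP.
Qed.

HB.instance Definition _ :=
  GRing.isLinear.Build k V W *:%R degreewise degreewise_linear.

Lemma degreewise_homog g v : homog g v -> degreewise v = phi g v.
Proof.
move=> hv; rewrite (@degreewiseE v [:: g]) ?big_seq1 ?gcomp_id //.
split=> // [g'|g'|]; [exact: gcomp_homog| |by rewrite big_seq1 gcomp_id].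
by rewrite inE => /(gcomp_neq hv).
Qed.

End GradedSums.

(** For a retraction [p] of [i], the map [f \o p] extends [f] but need not be graded. Keeping only
    the degree [d] part of its value in degree [d] makes it graded, and changes nothing on the image
    of [i] since [i] and [f] preserve degrees. *)
Lemma graded_extension (k : fieldType) (G : groupType)
    (N N' M : gradedSpaceType k G) (i : {linear N -> N'}) (f : {linear N -> M}) :
  graded_map i -> injective i -> graded_map f ->
  exists g : {linear N' -> M}, graded_map g /\ forall n, g (i n) = f n.
Proof.
move=> gr_i inj_i gr_f; have [p ip] := linear_retraction inj_i.
exists (degreewise (fun d => gcomp d \o (f \o p))); split=> [d v hv|n].
  by rewrite /= (degreewise_homog _ hv); apply: gcomp_homog.
elim/homog_ind: n => [u v IHu IHv||d v hv].
- by rewrite !linearD /= IHu IHv.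
- by rewrite !linear0.
- by rewrite /= (degreewise_homog _ (gr_i d v hv)) /= ip gcomp_id //; apply: gr_f.
Qed.

(** * Functoriality and associativity of the tensor product *)

Section TensorMaps.
Variable k : fieldType.
Implicit Types U V W : lmodType k.

HB.instance Definition _ U V W (B : {bilinear U -> V -> W}) :=
  GRing.isLinear.Build k (tensor U V) W *:%R (tlift B) (tlift_is_linear B).

Definition tens_fun U V U' V' (f : U -> U') (g : V -> V') u v := f u ⊗ g v.

Lemma tens_fun_bilinear U V U' V' (f : {linear U -> U'}) (g : {linear V -> V'}) :
  bilinear_for *:%R *:%R (tens_fun f g).
Proof.
by split=> [v a u u'|u a v v']; rewrite /tens_fun linearP ?linearPl ?linearPr.
Qed.

HB.instance Definition _ U V U' V' (f : {linear U -> U'})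
    (g : {linear V -> V'}) :=
  bilinear_isBilinear.Build k U V (tensor U' V') *:%R *:%R (tens_fun f g)
    (tens_fun_bilinear f g).

HB.instance Definition _ U V U' V' (f : {linear U -> U'})
    (g : {linear V -> V'}) :=
  GRing.isLinear.Build k (tensor U V) (tensor U' V') *:%R (tensor_map f g)
    (tlift_is_linear (tens_fun f g)).

Lemma tensor_map_tens U V U' V' (f : {linear U -> U'})
    (g : {linear V -> V'}) u v :
  tensor_map f g (u ⊗ v) = f u ⊗ g v.
Proof. exact: (tlift_tens (tens_fun f g)). Qed.

(** The zero tensor needs no case of its own, being [0 ⊗ 0]. *)
Lemma tensor_ind U V (P : tensor U V -> Prop) :
  (forall s t, P s -> P t -> P (s + t)) -> (forall u v, P (u ⊗ v)) ->
  forall t, P t.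
Proof.
move=> PD Pt t; rewrite (tensor_span t); apply: (big_ind P) => //.
by rewrite -(linear0l (@tens k U V) 0); apply: Pt.
Qed.

Definition tens_assoc U V W (t : tensor U V) (w : W) : tensor U (tensor V W) :=
  tensor_map idfun (applyr (@tens k V W) w) t.

Lemma tens_assoc_bilinear U V W : bilinear_for *:%R *:%R (@tens_assoc U V W).
Proof.
split=> [w a s t|t a w w']; first by rewrite /tens_assoc linearP.
rewrite /tens_assoc; elim/tensor_ind: t => [s t IHs IHt|u v].
  by rewrite !linearD /= IHs IHt scalerDr addrACA.
by rewrite !tensor_map_tens /= !linearPr.
Qed.

HB.instance Definition _ U V W :=
  bilinear_isBilinear.Build k (tensor U V) W (tensor U (tensor V W))
    *:%R *:%R (@tens_assoc U V W) (@tens_assoc_bilinear U V W).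

HB.instance Definition _ U V W :=
  GRing.isLinear.Build k (tensor (tensor U V) W) (tensor U (tensor V W)) *:%R
    (@tensorA k U V W) (tlift_is_linear (@tens_assoc U V W)).

Lemma tensorA_tens U V W (u : U) (v : V) (w : W) :
  tensorA ((u ⊗ v) ⊗ w) = u ⊗ (v ⊗ w).
Proof.
rewrite [LHS](tlift_tens (@tens_assoc U V W)).
exact: (tensor_map_tens idfun (applyr (@tens k V W) w)).
Qed.

Lemma tensor_map_comp U V U' V' U'' V'' (f : {linear U -> U'})
    (g : {linear V -> V'})
    (f' : {linear U' -> U''}) (g' : {linear V' -> V''}) t :
  tensor_map f' g' (tensor_map f g t) = tensor_map (f' \o f) (g' \o g) t.
Proof.
elim/tensor_ind: t => [s t IHs IHt|u v]; first by rewrite !linearD /= IHs IHt.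
by rewrite !tensor_map_tens.
Qed.

Lemma tensorA_map (U V W W' : lmodType k) (g : {linear W -> W'})
    (t : tensor (tensor U V) W) :
  tensorA (tensor_map idfun g t) =
  tensor_map idfun (tensor_map idfun g) (tensorA t).
Proof.
elim/tensor_ind: t => [s t IHs IHt|t u].
  by rewrite [tensor_map _ _ _]linearD !linearD /= IHs IHt.
rewrite tensor_map_tens /=; elim/tensor_ind: t => [s t IHs IHt|x y].
  by rewrite !linearDl !linearD /= IHs IHt.
by rewrite !tensorA_tens tensor_map_tens /= tensor_map_tens.
Qed.

End TensorMaps.

(** * Expressions by homogeneous elementary tensors *)

Section HomogSum.
Variables (k : fieldType) (G : groupType) (U V : gradedSpaceType k G).

Lemma tensor_homog_ind (P : tensor U V -> Prop) :
  (forall s t, P s -> P t -> P (s + t)) ->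
  (forall g g' u v, homog g u -> homog g' v -> P (u ⊗ v)) ->
  forall t, P t.
Proof.
move=> PD Pt; have P0 : P 0.
  by rewrite -(linear0l (@tens k U V) 0); apply: (Pt 1%g 1%g); apply: homog0.
elim/tensor_ind => // u v; elim/(@homog_ind k G U): u => [u u' Pu Pu'||g u hu].
- by rewrite linearDl; apply: PD.
- by rewrite linear0l.
elim/(@homog_ind k G V): v => [v v' Pv Pv'||g' v hv].
- by rewrite linearDr; apply: PD.
- by rewrite linear0r.
- exact: Pt hu hv.
Qed.

(** Supplies the expressions at which the compatibility axioms, stated through [twisted_prod], are
    evaluated. *)
Lemma homog_sum_ex (t : tensor U V) :
  exists n (u : 'I_n -> U) (v : 'I_n -> V) du dv, homog_sum u v du dv t.
Proof.
elim/tensor_homog_ind: t => [s t|g g' u v hu hv]; last first.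
  exists 1%N, (fun=> u), (fun=> v), (fun=> g), (fun=> g').
  by split=> //; rewrite big_ord1.
move=> [n [u [v [du [dv [hu hv ->]]]]]] [n' [u' [v' [du' [dv' [hu' hv' ->]]]]]].
pose join T (x : 'I_n -> T) (x' : 'I_n' -> T) (i : 'I_(n + n')) :=
  match split i with inl j => x j | inr j => x' j end.
exists (n + n')%N, (join _ u u'), (join _ v v'), (join _ du du'), (join _ dv dv').
split=> [i|i|]; rewrite /join; try by case: split.
rewrite big_split_ord /=; congr (_ + _); apply: eq_bigr => i _.
  by rewrite (unsplitK (inl i)).
by rewrite (unsplitK (inr i)).
Qed.

End HomogSum.

(** * The bicharacter as a linear operator *)

Section Twist.
Variables (k : fieldType) (G : groupType) (chi : bicharacter k G).
Variable V : gradedSpaceType k G.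

(** Turns the factor of a twisted product into a linear map, so that such a product by a fixed
    element becomes a sum of maps [tensor_map]. *)
Definition twist (g : G) : V -> V :=
  degreewise (fun g' => chi g g' \*: (idfun : {linear V -> V})).

HB.instance Definition _ g := GRing.Linear.on (twist g).

Lemma twist_homog g g' v : homog g' v -> twist g v = chi g g' *: v.
Proof. by move=> hv; rewrite /twist (degreewise_homog _ hv). Qed.

End Twist.

(** * The maps Psi and Phi on H ⊗ M *)

Section Galois.
Variables (k : fieldType) (G : groupType) (chi : bicharacter k G).
Variables (H : colourHopfType chi).
Implicit Types (phi psi : {linear H -> H}) (h : H).

Definition mul_tens (V : lmodType k) (phi : H -> H) h :
    tensor H V -> tensor H V :=
  tensor_map (cmul h \o phi) idfun.

HB.instance Definition _ (V : lmodType k) phi h :=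
  GRing.Linear.on (@mul_tens V phi h).

Lemma mul_tens_bilinear (V : lmodType k) phi :
  bilinear_for *:%R *:%R (@mul_tens V phi).
Proof.
split=> [t a h h'|h a s t]; rewrite /mul_tens; last by rewrite linearP.
elim/tensor_ind: t => [s t IHs IHt|x v].
  by rewrite !linearD /= IHs IHt scalerDr addrACA.
by rewrite !tensor_map_tens /= !linearPl.
Qed.

HB.instance Definition _ (V : lmodType k) phi :=
  bilinear_isBilinear.Build k H (tensor H V) (tensor H V) *:%R *:%R
    (@mul_tens V phi) (mul_tens_bilinear V phi).

Lemma mul_tens_tens (V : lmodType k) phi h x (v : V) :
  mul_tens phi h (x ⊗ v) = (h ∙ phi x) ⊗ v.
Proof. exact: (tensor_map_tens (cmul h \o phi) idfun). Qed.

Definition convolution (phi psi : H -> H) (x y : H) : H := phi x ∙ psi y.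

Lemma convolution_bilinear phi psi :
  bilinear_for *:%R *:%R (convolution phi psi).
Proof.
by split=> [z a x y|z a x y]; rewrite /convolution linearP ?linearPl ?linearPr.
Qed.

HB.instance Definition _ phi psi :=
  bilinear_isBilinear.Build k H H H *:%R *:%R
    (convolution phi psi) (convolution_bilinear phi psi).

Variable M : gradedComodType H.

Definition counit_act (h : H) (m : M) : M := (counit h : k) *: m.

Lemma counit_act_bilinear : bilinear_for *:%R *:%R counit_act.
Proof.
split=> [m a h h'|h a m m']; rewrite /counit_act; last first.
  by rewrite scalerDr scalerA mulrC -scalerA.
  have -> : counit (a *: h + h') = (a * counit h + counit h' : k).
    by rewrite linearP.
  by rewrite scalerDl -scalerA.
Qed.

HB.instance Definition _ :=
  bilinear_isBilinear.Build k H M M *:%R *:%R counit_act counit_act_bilinear.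

(** The map h ⊗ m |-> h phi(m_(-1)) ⊗ m_(0): Psi for [phi = idfun], Phi for [phi = antipode]. *)
Definition galois phi : tensor H M -> tensor H M :=
  tlift (mul_tens phi) \o tensor_map idfun coact.

HB.instance Definition _ phi := GRing.Linear.on (galois phi).

Lemma galois_tens phi h (m : M) :
  galois phi (h ⊗ m) = mul_tens phi h (coact m).
Proof. by rewrite /galois /= (tensor_map_tens idfun coact) tlift_tens. Qed.

Lemma mul_tens_assoc phi psi h (t : tensor H H) (m : M) :
  tlift (mul_tens phi) (mul_tens psi h (tensorA (t ⊗ m))) =
  (h ∙ tlift (convolution psi phi) t) ⊗ m.
Proof.
elim/tensor_ind: t => [s t IHs IHt|x y].
  rewrite linearDl [tensorA _]linearD linearDr linearD /= IHs IHt.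
  by rewrite [tlift _ (s + t)]linearD linearDr linearDl.
by rewrite tensorA_tens mul_tens_tens !tlift_tens /= mul_tens_tens cmulA.
Qed.

(** By coassociativity the composite sends h ⊗ m to h psi(m_(-2)) phi(m_(-1)) ⊗ m_(0). The
    hypothesis replaces the middle product by a counit, which the counit axiom of M absorbs. *)
Lemma galoisK phi psi :
  (forall h, tlift (convolution psi phi) (comul h) =
     (counit h : k) *: (cone : H)) ->
  cancel (galois psi) (galois phi).
Proof.
move=> psi_phi t; elim/tensor_ind: t => [s t IHs IHt|h m].
  by rewrite !linearD /= IHs IHt.
rewrite galois_tens /galois /= /mul_tens tensor_map_comp.
transitivity (tlift (@mul_tens M phi)
    (mul_tens psi h (tensor_map idfun coact (coact m)))).
  by rewrite [mul_tens psi h _]tensor_map_comp.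
rewrite -coactA -[in RHS](coact_counit m); move: (coact m) => t.
rewrite -/counit_act -[X in tensor_map comul X]/idfun.
elim/tensor_ind: t => [s t IHs IHt|x y].
  rewrite [tensor_map _ _ _]linearD [tensorA _]linearD linearDr linearD /=.
  by rewrite IHs IHt [tlift _ (s + t)]linearD linearDr.
rewrite (tensor_map_tens comul idfun) mul_tens_assoc psi_phi tlift_tens /=.
by rewrite /counit_act !linearZr_LR /= cmulr1 linearZl_LR.
Qed.

End Galois.

Arguments mul_tens : simpl never.

(** * Degrees of maps on tensor products *)

Section GradedTensorMaps.
Variables (k : fieldType) (G : groupType).

Lemma tlift_homog (U V W : gradedSpaceType k G) (B : {bilinear U -> V -> W}) :
  (forall g g' u v, homog g u -> homog g' v -> homog (g * g')%g (B u v)) ->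
  forall g t, homog g t -> homog g (tlift B t).
Proof.
move=> hB g _ [n [u [v [du [dv [[hu hv ->] dg]]]]]].
rewrite linear_sum; apply: (big_ind (homog g)) => [||i _] /=.
- exact: homog0.
- by move=> x y; apply: homogD.
- by rewrite tlift_tens -(dg i); apply: hB.
Qed.

Lemma tensor_map_graded (U V U' V' : gradedSpaceType k G)
    (f : {linear U -> U'}) (g : {linear V -> V'}) :
  graded_map f -> graded_map g -> graded_map (tensor_map f g).
Proof.
move=> gr_f gr_g d t.
apply: (@tlift_homog U V (tensor U' V') (tens_fun f g)) => a b u v hu hv.
by apply: tensor_homog_tens; [apply: gr_f | apply: gr_g].
Qed.

End GradedTensorMaps.

(** * The retraction lambda of the coaction, and its colinearity *)

Section Average.
Variables (k : fieldType) (G : groupType) (chi : bicharacter k G).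
Variables (H : colourHopfType chi) (A : comodColourAlgType H).
Variables (theta : {linear H -> A}) (theta_colinear : colinear theta).
Hypothesis theta1 : theta (cone : H) = (cone : A).
Variable M : colourHopfModType A.

Definition act_by (h : H) (m : M) : M := gact (theta h) m.

Lemma act_by_bilinear : bilinear_for *:%R *:%R act_by.
Proof. by split=> [m a h h'|h a m m']; rewrite /act_by linearP ?linearPl. Qed.

HB.instance Definition _ :=
  bilinear_isBilinear.Build k H M M *:%R *:%R act_by act_by_bilinear.

Definition average : tensor H M -> M := tlift act_by \o galois antipode.

HB.instance Definition _ := GRing.Linear.on average.

(** Used as surjectivity of Psi: an arbitrary tensor may be replaced by some Psi (h ⊗ m). *)
Lemma galois_idfunK : cancel (@galois k G chi H M antipode) (galois idfun).
Proof. by apply: galoisK => h; apply: antipodel. Qed.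

Lemma average_galois t : average (galois idfun t) = tlift act_by t.
Proof. by rewrite /average /= galoisK // => h; apply: antipoder. Qed.

(** The coaction of m is Psi (1 ⊗ m), which lambda sends to theta(1) m = m. *)
Lemma average_coact m : average (coact m) = m.
Proof.
have -> : coact m = galois idfun (cone ⊗ m).
  rewrite galois_tens; elim/tensor_ind: (coact m) => [s t IHs IHt|x y].
    by rewrite linearDr /= -IHs -IHt.
  by rewrite mul_tens_tens cmul1r.
by rewrite average_galois tlift_tens /= /act_by theta1 gact1.
Qed.

Lemma average_graded : graded_map average.
Proof.
move=> g t ht; rewrite /average /=.
apply: (@tlift_homog _ _ H M M act_by) => [a b h m hh hm|].
  by apply: gact_homog => //; apply: theta_colinear.1.
have [n [u [v [du [dv [[hu hv -> dg]]]]]]] := ht.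
rewrite linear_sum; apply: (big_ind (homog g)) => [||i _].
- exact: homog0.
- by move=> x y; apply: homogD.
rewrite /= galois_tens -(dg i).
have [n' [x [y [dx [dy [[hx hy ->] dxy]]]]]] := coact_graded _ _ (hv i).
rewrite linear_sumr; apply: (big_ind (homog _)) => [||j _].
- exact: homog0.
- by move=> ? ?; apply: homogD.
rewrite /= mul_tens_tens -(dxy j) mulgA; apply: tensor_homog_tens => //.
by apply: cmul_homog => //; apply: antipode_graded.
Qed.

(** Multiplicativity of the coproduct for the first leg h m_(-1) of Psi (h ⊗ m). Moving [b i] past
    the first leg of the coproduct of [x] costs exactly the twist by [db i]. *)
Lemma average_comul_mul h x y n (a b : 'I_n -> H) da db :
  homog_sum a b da db (comul h) ->
  tensor_map idfun average (tensorA (comul (h ∙ x) ⊗ y)) =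
  \sum_i tensor_map (cmul (a i) \o twist chi (db i))
           (average \o mul_tens idfun (b i)) (tensorA (comul x ⊗ y)).
Proof.
move=> hh; have [n' [c [d [dc [dd hx]]]]] := homog_sum_ex (comul x).
rewrite (comulM _ _ _ _ _ _ _ _ _ _ _ _ hh hx).
have [hc hd ->] := hx.
rewrite linear_sumlz [tensorA _]linear_sum linear_sum; apply: eq_bigr => i _ /=.
rewrite !linear_sumlz ![tensorA _]linear_sum !linear_sum.
apply: eq_bigr => j _ /=.
rewrite linearZl_LR !linearZ /= !tensorA_tens (tensor_map_tens idfun average).
rewrite (tensor_map_tens (cmul (a i) \o twist chi (db i))) /=.
rewrite (twist_homog _ _ (hc j)) linearZr_LR linearZl_LR.
by rewrite mul_tens_tens.
Qed.

(** On Psi (h ⊗ m), the left side is the coaction of theta(h) m. The Hopf module axiom expands it,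
    colinearity of theta giving h_1 ⊗ theta(h_2) for theta(h). *)
Lemma coact_average t :
  coact (average t) =
  tensor_map idfun average (tensorA (tensor_map comul idfun t)).
Proof.
rewrite -(galois_idfunK t).
elim/tensor_homog_ind: (galois antipode t) => {t} [s t IHs IHt|g g' h m _ _].
  by rewrite [galois idfun _]linearD !linearD /= IHs IHt.
have [n [a [b [da [db hh]]]]] := homog_sum_ex (comul h).
have [n' [x [y [dx [dy hm]]]]] := homog_sum_ex (coact m).
have hth : homog_sum a (theta \o b) da db (coact (theta h)).
  have [ha hb hE] := hh; split=> // [i|]; first exact: theta_colinear.1.
  transitivity (tensor_map idfun theta (comul h)); first exact: theta_colinear.2.
  rewrite hE linear_sum.
  by apply: eq_bigr => i _; rewrite /= (tensor_map_tens idfun).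
rewrite average_galois tlift_tens /= /act_by.
rewrite (coact_gact _ _ _ _ _ _ _ _ _ _ _ _ hth hm).
rewrite galois_tens; have [hx hy mE] := hm.
(* Each theta(b) y is read backwards as lambda (Psi (b ⊗ y)), so that lambda appears on both
   sides. *)
transitivity (\sum_i tensor_map (cmul (a i) \o twist chi (db i))
   (average \o mul_tens idfun (b i)) (tensor_map idfun coact (coact m))).
  apply: eq_bigr => i _; rewrite mE [tensor_map idfun _ _]linear_sum linear_sum.
  apply: eq_bigr => j _ /=.
  rewrite (tensor_map_tens idfun) tensor_map_tens /= -galois_tens.
  rewrite average_galois tlift_tens (twist_homog _ _ (hx j)).
  by rewrite linearZr_LR linearZl_LR.
(* Coassociativity trades the second coaction on m for a coproduct of m_(-1). *)
rewrite -coactA -[X in tensor_map comul X]/idfun mE.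
transitivity (\sum_i \sum_j tensor_map (cmul (a i) \o twist chi (db i))
    (average \o mul_tens idfun (b i)) (tensorA (comul (x j) ⊗ y j))).
  apply: eq_bigr => i _.
  rewrite [tensor_map comul _ _]linear_sum [tensorA _]linear_sum linear_sum.
  by apply: eq_bigr => j _; rewrite /= (tensor_map_tens comul idfun).
rewrite exchange_big [mul_tens _ _ _]linear_sum [tensor_map comul _ _]linear_sum.
rewrite [tensorA _]linear_sum linear_sum; apply: eq_bigr => j _ /=.
by rewrite mul_tens_tens (tensor_map_tens comul idfun) (average_comul_mul _ _ hh).
Qed.

End Average.

Arguments average {k G chi H A} theta {M} _.

(** * The diagonal action, and A-linearity of lambda *)

Section TwistedAction.
Variables (k : fieldType) (G : groupType) (chi : bicharacter k G).
Variables (H : colourHopfType chi) (A : comodColourAlgType H).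
Variables (n : nat) (a : 'I_n -> H) (b : 'I_n -> A) (db : 'I_n -> G).

(* The diagonal action on H ⊗ N of an element c of A with coaction
   \sum_i a i ⊗ b i, the b i being of degrees db i. *)
Definition twisted_act (N : gradedModType A) : tensor H N -> tensor H N :=
  fun t => \sum_i tensor_map (cmul (a i) \o twist chi (db i)) (gact (b i)) t.

Lemma twisted_act_linear N : linear (@twisted_act N).
Proof.
move=> l s t; rewrite /twisted_act scaler_sumr -big_split; apply: eq_bigr => i _.
by rewrite linearP.
Qed.

HB.instance Definition _ (N : gradedModType A) :=
  GRing.isLinear.Build k (tensor H N) (tensor H N) *:%R (@twisted_act N)
    (@twisted_act_linear N).

Lemma twisted_act_map (N N' : gradedModType A) (g : {linear N -> N'}) t :
  graded_linear g ->
  tensor_map idfun g (twisted_act t) = twisted_act (tensor_map idfun g t).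
Proof.
move=> [_ gA]; elim/tensor_ind: t => [s t IHs IHt|x y].
  by rewrite [twisted_act _]linearD linearD [tensor_map _ _ _ in RHS]linearD
    linearD /= IHs IHt.
rewrite (tensor_map_tens idfun g) linear_sum; apply: eq_bigr => i _ /=.
by rewrite !tensor_map_tens /= gA.
Qed.

Lemma coact_gact_twisted (N : colourHopfModType A) da c (m : N) :
  homog_sum a b da db (coact c) -> coact (gact c m) = twisted_act (coact m).
Proof.
move=> hc; have [n' [x [y [dx [dy hm]]]]] := homog_sum_ex (coact m).
rewrite (coact_gact _ _ _ _ _ _ _ _ _ _ _ _ hc hm); have [hx _ ->] := hm.
apply: eq_bigr => i _; rewrite linear_sum; apply: eq_bigr => j _ /=.
by rewrite tensor_map_tens /= (twist_homog _ _ (hx j)) linearZr_LR linearZl_LR.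
Qed.

Variables (theta : {linear H -> A}) (theta_colinear : colinear theta).
Variable M : colourHopfModType A.
Hypotheses (comA : colour_commutative chi A) (comH : colour_commutative chi H).

(** On Psi (h ⊗ m) with h of degree g, commuting c past theta(h) in A costs [chi d g]. The diagonal
    action costs the same: [chi (db i) g] from the twist and [chi (da i) g] from commuting [a i]
    past h in H, where [da i * db i = d]. *)
Lemma average_twisted da c d (t : tensor H M) :
  homog d c -> homog_sum a b da db (coact c) ->
  (forall i, (da i * db i)%g = d) ->
  average theta (twisted_act t) = gact c (average theta t).
Proof.
move=> hc hcE dd; rewrite -(galois_idfunK t).
elim/tensor_homog_ind: (galois antipode t) => {t} [s t IHs IHt|g g' h m hh hm].
  by rewrite [galois idfun _]linearD !linearD /= IHs IHt.
have [n' [x [y [dx [dy [hx _ mE]]]]]] := homog_sum_ex (coact m).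
rewrite average_galois tlift_tens /= /act_by -gactA.
rewrite (comA hc (theta_colinear.1 _ _ hh)) linearZl_LR gactA.
have -> : twisted_act (galois idfun (h ⊗ m)) =
    chi d g *: galois idfun (h ⊗ (gact c m : M)).
  rewrite !galois_tens (coact_gact_twisted _ hcE) mE.
  rewrite [in RHS]linear_sumr scaler_sumr; apply: eq_bigr => i _.
  rewrite linear_sumr linear_sum [tensor_map _ _ _ in RHS]linear_sum.
  rewrite linear_sumr scaler_sumr.
  apply: eq_bigr => j _ /=.
  rewrite mul_tens_tens !tensor_map_tens /= mul_tens_tens /=.
  rewrite (twist_homog _ _ (cmul_homog _ _ _ _ hh (hx j))).
  rewrite (twist_homog _ _ (hx j)).
  have [ha _ _] := hcE; rewrite !linearZr_LR cmulA (comH (ha i) hh).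
  rewrite !(linearZl_LR, linearZr_LR) -cmulA !scalerA -(dd i).
  by rewrite bicharMl bicharMr -mulrA [chi (da i) g * _]mulrC -scalerA.
by rewrite linearZ /= average_galois tlift_tens.
Qed.

End TwistedAction.

(** * Averaging a graded linear map into a colinear one *)

Section Extension.
Variables (k : fieldType) (G : groupType) (chi : bicharacter k G).
Variables (H : colourHopfType chi) (A : comodColourAlgType H).
Variables (theta : {linear H -> A}) (theta_colinear : colinear theta).
Hypothesis theta1 : theta (cone : H) = (cone : A).
Variable M : colourHopfModType A.

Section Comodule.
Variables (N : gradedComodType H) (g : {linear N -> M}).

Definition averaged : N -> M := average theta \o tensor_map idfun g \o coact.

HB.instance Definition _ := GRing.Linear.on averaged.

(** A composite of three colinear maps, with H coacting through the first factor of the tensor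
    products: the coaction of N by coassociativity, [tensor_map idfun g] by naturality, lambda by
    [coact_average]. *)
Lemma averaged_colinear : graded_map g -> colinear averaged.
Proof.
move=> gr_g; split=> [d x hx|x].
  apply: average_graded => //; apply: tensor_map_graded => //.
  exact: coact_graded.
rewrite /averaged /= (coact_average theta_colinear) tensor_map_comp.
transitivity (tensor_map idfun (average theta) (tensor_map idfun
    (tensor_map idfun g) (tensor_map idfun coact (coact x)))); last first.
  by rewrite !tensor_map_comp.
by rewrite -coactA -[X in tensor_map comul X]/idfun -tensorA_map tensor_map_comp.
Qed.

(** Colinearity of [i] and [f] turns the averaged map at [i x] into lambda of the coaction of [f x],
    which is [f x]. *)
Lemma averaged_extends (N0 : gradedComodType H) (i : {linear N0 -> N})
    (f : {linear N0 -> M}) :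
  colinear i -> colinear f -> (forall x, g (i x) = f x) ->
  forall x, averaged (i x) = f x.
Proof.
move=> [_ i_col] [_ f_col] gi x.
rewrite -[RHS](average_coact theta1) f_col /averaged /= i_col.
rewrite -[X in tensor_map X i]/idfun -[X in tensor_map X f]/idfun tensor_map_comp.
congr (average theta _).
by elim/tensor_ind: (coact x) => [s t IHs IHt|u v];
  rewrite ?linearD /= ?IHs ?IHt // !tensor_map_tens /= gi.
Qed.

End Comodule.

Lemma averaged_gact (N : colourHopfModType A) (g : {linear N -> M}) :
  colour_commutative chi A -> colour_commutative chi H ->
  graded_linear g ->
  forall (c : A) (x : N), averaged g (gact c x) = gact c (averaged g x).
Proof.
move=> comA comH gA c x.
(* Commuting c past theta(h) needs a degree, so c is reduced to homogeneous elements by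
   linearity. *)
elim/homog_ind: c => [c c' IHc IHc'||d c hc].
- by rewrite !linearDl linearD /= IHc IHc'.
- by rewrite !linear0l linear0.
have [n [a [b [da [db [hcE dd]]]]]] := coact_graded _ _ hc.
rewrite /averaged /= (coact_gact_twisted _ hcE) twisted_act_map //.
exact: (average_twisted theta_colinear comA comH _ hc hcE dd).
Qed.

End Extension.

Theorem theorem3p8 (k : fieldType) (G : groupType)
    (commG : forall g g' : G, (g * g')%g = (g' * g)%g)
    (chi : bicharacter k G) (H : colourHopfType chi)
    (A : comodColourAlgType H)
    (theta : {linear H -> A}) (theta_colinear : colinear theta)
    (theta1 : theta (cone : H) = (cone : A)) :
  (forall M : colourHopfModType A, gr_injective_comod M)
  /\
  (colour_commutative chi A -> colour_commutative chi H ->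
   symmetric_bichar chi ->
   forall M : colourHopfModType A,
     injective_gradedMod M -> injective_colourHopfMod M).
Proof.
split=> [M N N' i f i_col inj_i f_col|
  comA comH _ M injM N N' i f [iA i_col] inj_i [fA f_col]].
  have [g [gr_g gi]] := graded_extension i_col.1 inj_i f_col.1.
  exists (averaged theta g); split; first exact: averaged_colinear.
  exact: averaged_extends.
have [g [gA gi]] := injM _ _ i f iA inj_i fA.
have av_col := averaged_colinear theta_colinear gA.1.
exists (averaged theta g); split; last exact: averaged_extends.
split=> //; split; first exact: av_col.1.
exact: averaged_gact.
Qed.
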